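(* Let $\mathcal{A}\in\mathbb{R}[t]^{n\times n}$ have degree at most $d$, and consider the problem $$\min\ \|\Delta\mathcal{A}\|_F^2\quad\text{subject to}\quad \mathrm{Adj}(\mathcal{A}+\Delta\mathcal{A})=\mathcal{F}h,\quad \mathcal{N}_h\mathrm{vec}(h)=1,$$ over perturbations $\Delta\mathcal{A}$ of a prescribed affine structure, $\mathcal{F}\in\mathbb{R}[t]^{n\times n}$ and $h\in\mathbb{R}[t]$. Let $x^\star=(\Delta\mathcal{A}^\star,\mathcal{F}^\star,h^\star)$ be a minimal (attained) solution with $\mathcal{A}+\Delta\mathcal{A}^\star$ of full rank at which Lagrange multipliers exist, and let $\lambda^\star$ be a vector of Lagrange multipliers of minimal norm at $x^\star$. If $h^\star$ is monic and of maximal degree, and the minimal structured perturbation $\|\Delta\mathcal{A}^\star\|$ is sufficiently small, then the second-order sufficiency condition holds at $z^\star=(x^\star,\lambda^\star)$, i.e. $$y^T\,\nabla^2_{xx}L(z^\star)\,y>0\quad\text{for every non-zero } y\in\ker J(z^\star).$$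
   Context: $\|\cdot\|_F$ is the Euclidean norm of all coefficients of all entries of a matrix polynomial. $\mathrm{Adj}$ is the adjugate (transpose of the cofactor matrix), with entries regarded as having degree at most $(n-1)d$. $\mathrm{vec}$ stacks the coefficient vectors (padded with zeros up to the degree bound) of a polynomial or of all entries of a matrix polynomial. Full rank means non-zero determinant. The degree $m\ge1$ of $h$ is prescribed. The variables $x=(\Delta\mathcal{A},\mathcal{F},h)$ are the free parameters of the affine structure of $\Delta\mathcal{A}$, the coefficients of the entries of $\mathcal{F}$ (of degree at most $(n-1)d-m$) and the coefficients of $h$ (of degree at most $m$). $\mathcal{N}_h\in\mathbb{R}^{1\times(m+1)}$ is the normalization vector for which $\mathcal{N}_h\mathrm{vec}(h)$ is the coefficient of $t^m$ in $h$, so the second constraint says that $h$ is monic of degree $m$. ''$h^\star$ of maximal degree'' means that $h^\star$ is a common divisor of maximal degree, i.e. the gcd, of the entries of $\mathrm{Adj}(\mathcal{A}+\Delta\mathcal{A}^\star)$. The Lagrangian is $$L(x,\lambda)=\|\Delta\mathcal{A}\|_F^2+\lambda^T\begin{pmatrix}\mathrm{vec}(\mathrm{Adj}(\mathcal{A}+\Delta\mathcal{A})-\mathcal{F}h)\\ \mathcal{N}_h\mathrm{vec}(h)-1\end{pmatrix},$$ $J$ is the Jacobian matrix with respect to $x$ of the vector of constraints multiplying $\lambda^T$, and $\lambda$ is a vector of Lagrange multipliers at $x^\star$ if $\nabla L(x^\star,\lambda)=0$. *)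

(* Defs.v *)
From HB Require Import structures.
From mathcomp Require Import all_boot all_order all_algebra.
From mathcomp Require Import all_classical all_reals all_analysis.

Set Implicit Arguments.
Unset Strict Implicit.
Unset Printing Implicit Defensive.

Import Order.TTheory GRing.Theory Num.Theory.
Import numFieldNormedType.Exports.

Local Open Scope ring_scope.

(* Vectors are row vectors, as in the derive library; the norm `|v| of that   *)
(* library on 'rV[R]_N is the sup norm, whence the explicit Euclidean one.    *)
Definition norm2 (R : realType) (N : nat) (v : 'rV[R]_N) : R :=
  Num.sqrt (\sum_i v 0 i ^+ 2).

Definition grad (R : realType) (N : nat) (f : 'rV[R]_N -> R) (x : 'rV[R]_N) :
    'rV[R]_N :=
  \row_i 'D_(delta_mx 0 i) f x.

Definition hess (R : realType) (N : nat) (f : 'rV[R]_N -> R) (x : 'rV[R]_N) :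
    'M[R]_N :=
  \matrix_(i, j) 'D_(delta_mx 0 i) ('D_(delta_mx 0 j) f) x.

Definition degmx_le (R : realType) (n d : nat) (M : 'M[{poly R}]_n) : Prop :=
  forall i j, (size (M i j) <= d.+1)%N.

Definition normF (R : realType) (n : nat) (M : 'M[{poly R}]_n) : R :=
  Num.sqrt (\sum_i \sum_j \sum_(l < size (M i j)) (M i j)`_l ^+ 2).

(* Stacks the first b coefficients of every entry, i.e. entries are regarded  *)
(* as having degree at most b - 1.                                            *)
Definition vec_mxpoly (R : realType) (n b : nat) (M : 'M[{poly R}]_n) :
    'rV[R]_(n * n * b) :=
  mxvec (\matrix_(r < n * n) (poly_rV (mxvec M 0 r) : 'rV[R]_b)).

Definition mxpoly_vec (R : realType) (n b : nat) (v : 'rV[R]_(n * n * b)) :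
    'M[{poly R}]_n :=
  vec_mx (\row_(r < n * n) rVpoly (row r (vec_mx v))).

Definition common_divisor (R : realType) (n : nat) (g : {poly R})
    (M : 'M[{poly R}]_n) : Prop :=
  forall i j, g %| M i j.

Definition max_common_divisor (R : realType) (n : nat) (g : {poly R})
    (M : 'M[{poly R}]_n) : Prop :=
  common_divisor g M /\
  forall g', common_divisor g' M -> (size g' <= size g)%N.

(* An affine structure with k free parameters p is given by an offset S0 and  *)
(* directions S: the perturbations are S0 + \sum_i p_i S_i.                   *)
Definition affine_mx (R : realType) (n k : nat) (S0 : 'M[{poly R}]_n)
    (S : 'I_k -> 'M[{poly R}]_n) (p : 'rV[R]_k) : 'M[{poly R}]_n :=
  S0 + \sum_(i < k) (p 0 i)%:P *: S i.

Definition free_directions (R : realType) (n k : nat)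
    (S : 'I_k -> 'M[{poly R}]_n) : Prop :=
  forall p : 'rV[R]_k, affine_mx 0 S p = 0 -> p = 0.

Definition adj_size (n d : nat) : nat := (n.-1 * d).+1.

(* Number of coefficients of a polynomial of degree at most (n-1)d - m; it is *)
(* 0 when this bound is negative.                                             *)
Definition cof_size (n d m : nat) : nat := adj_size n d - m.

Definition nvars (n d m k : nat) : nat :=
  k + (n * n * cof_size n d m + m.+1).

Definition nconstr (n d : nat) : nat := n * n * adj_size n d + 1.

Definition var_param (R : realType) (n d m k : nat)
    (x : 'rV[R]_(nvars n d m k)) : 'rV[R]_k := lsubmx x.

Definition var_F (R : realType) (n d m k : nat)
    (x : 'rV[R]_(nvars n d m k)) : 'M[{poly R}]_n :=
  mxpoly_vec (lsubmx (rsubmx x)).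

Definition var_h (R : realType) (n d m k : nat)
    (x : 'rV[R]_(nvars n d m k)) : {poly R} :=
  rVpoly (rsubmx (rsubmx x)).

Definition pert (R : realType) (n d m k : nat) (S0 : 'M[{poly R}]_n)
    (S : 'I_k -> 'M[{poly R}]_n) (x : 'rV[R]_(nvars n d m k)) :
    'M[{poly R}]_n :=
  affine_mx S0 S (var_param x).

Definition normalization (R : realType) (m : nat) : 'rV[R]_m.+1 :=
  delta_mx 0 ord_max.

Definition normalized (R : realType) (m : nat) (h : {poly R}) : 'M[R]_1 :=
  normalization R m *m (poly_rV h : 'rV[R]_m.+1)^T.

Definition constraints (R : realType) (n d m k : nat)
    (A S0 : 'M[{poly R}]_n) (S : 'I_k -> 'M[{poly R}]_n)
    (x : 'rV[R]_(nvars n d m k)) : 'rV[R]_(nconstr n d) :=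
  row_mx
    (vec_mxpoly (adj_size n d) (\adj (A + pert S0 S x) - var_h x *: var_F x))
    (normalized m (var_h x) - 1%:M).

Definition feasible (R : realType) (n d m k : nat)
    (A S0 : 'M[{poly R}]_n) (S : 'I_k -> 'M[{poly R}]_n)
    (x : 'rV[R]_(nvars n d m k)) : Prop :=
  \adj (A + pert S0 S x) = var_h x *: var_F x /\
  normalized m (var_h x) = 1%:M.

Definition objective (R : realType) (n d m k : nat) (S0 : 'M[{poly R}]_n)
    (S : 'I_k -> 'M[{poly R}]_n) (x : 'rV[R]_(nvars n d m k)) : R :=
  normF (pert S0 S x) ^+ 2.

Definition minimal_solution (R : realType) (n d m k : nat)
    (A S0 : 'M[{poly R}]_n) (S : 'I_k -> 'M[{poly R}]_n)
    (x : 'rV[R]_(nvars n d m k)) : Prop :=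
  feasible A S0 S x /\
  forall x' : 'rV[R]_(nvars n d m k),
    feasible A S0 S x' -> objective S0 S x <= objective S0 S x'.

Definition lagrangian (R : realType) (n d m k : nat)
    (A S0 : 'M[{poly R}]_n) (S : 'I_k -> 'M[{poly R}]_n)
    (x : 'rV[R]_(nvars n d m k)) (lam : 'rV[R]_(nconstr n d)) : R :=
  objective S0 S x + (lam *m (constraints A S0 S x)^T) 0 0.

Definition multipliers (R : realType) (n d m k : nat)
    (A S0 : 'M[{poly R}]_n) (S : 'I_k -> 'M[{poly R}]_n)
    (x : 'rV[R]_(nvars n d m k)) (lam : 'rV[R]_(nconstr n d)) : Prop :=
  grad (fun x' => lagrangian A S0 S x' lam) x = 0 /\
  grad (lagrangian A S0 S x) lam = 0.

Definition min_norm_multipliers (R : realType) (n d m k : nat)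
    (A S0 : 'M[{poly R}]_n) (S : 'I_k -> 'M[{poly R}]_n)
    (x : 'rV[R]_(nvars n d m k)) (lam : 'rV[R]_(nconstr n d)) : Prop :=
  multipliers A S0 S x lam /\
  forall mu, multipliers A S0 S x mu -> norm2 lam <= norm2 mu.

(* The library's 'J f x acts on row vectors from the right: it is the         *)
(* transpose of the usual Jacobian matrix, so J y = 0 reads y *m 'J f x = 0.  *)
Definition second_order_sufficient (R : realType) (n d m k : nat)
    (A S0 : 'M[{poly R}]_n) (S : 'I_k -> 'M[{poly R}]_n)
    (x : 'rV[R]_(nvars n d m k)) (lam : 'rV[R]_(nconstr n d)) : Prop :=
  forall y : 'rV[R]_(nvars n d m k), y != 0 ->
    y *m 'J (constraints A S0 S) x = 0 ->
    0 < (y *m hess (fun x' => lagrangian A S0 S x' lam) x *m y^T) 0 0.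

(* Main.v *)
(* Fix B = A + DeltaA*.  Translating the parameters by those of DeltaA* turns *)
(* the constraints into those of B with offset 0, and the solution into a     *)
(* point determined by B alone, because the gcd h of Adj B and its cofactor F *)
(* are.  So the Jacobian J and the second derivatives of the constraints do   *)
(* not depend on A or DeltaA*.                                                *)
(* If y in ker J does not move the parameters, then F dh + dF h = 0 with      *)
(* deg dh < deg h; as the entries of F have no common factor, h divides dh,   *)
(* hence dh = 0 and dF = 0.  So ker J is controlled by the parameters, and on *)
(* it |y|^2 <= C |dA|^2, where 2 |dA|^2 is the second derivative of the       *)
(* objective along y.                                                         *)
(* The gradient of the objective is linear in DeltaA*; applying a fixed       *)
(* partial inverse of J to it gives a multiplier of size O(|DeltaA*|), and    *)
(* the multiplier of minimal norm is no larger.  Hence the constraints        *)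
(* contribute only O(|DeltaA*|) |dA|^2 to the Hessian.                        *)

Require Import Defs.
From HB Require Import structures.
From mathcomp Require Import all_boot all_order all_algebra.
From mathcomp Require Import all_classical all_reals all_analysis ring lra zify.

Import Order.TTheory GRing.Theory Num.Theory.
Import numFieldNormedType.Exports.

Local Open Scope ring_scope.

Set Implicit Arguments.
Unset Strict Implicit.
Unset Printing Implicit Defensive.

(** * Polynomial functions and their derivatives *)

(** Once the problem is recentred at [B], the estimate is linear algebra on data fixed by [B] and
    [S]. Let [J] be the Jacobian at the recentred solution and [D] ([direction_mx]) the linear map
    from the variables to the coefficients of the perturbation. By [constraints_kernel_eq0], which
    rests on [max_common_divisor_cofactor], [J] and [D] together are injective, so a right inverse
    recovers each [y] in the kernel of [J] from [u = y *m D] ([jacobian_kernel_factor]).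

    Along such a [y] the objective contributes 2|u|^2 to the Hessian of the Lagrangian. The
    constraints contribute at most C2 |lam| |u|^2, and |lam| is at most C1 times the norm of the
    perturbation ([min_norm_multipliers_le]). A perturbation below 1/(1 + C1 C2) therefore leaves
    more than |u|^2, which is positive ([second_order_sufficient_near]).

    The constants can be fixed before [A] and [x] because [constraints_translate] removes [A] from
    the constraints and [recentred_solution_unique] removes the choice of the solution. *)

Section PolynomialFunctions.
Context (R : realType) (N : nat).
Implicit Types (f g : 'rV[R]_N -> R) (x y v : 'rV[R]_N).

(** Closed under directional derivatives ([polyfun_derive]), so one induction yields
    differentiability of every order needed for gradients, Jacobians and Hessians. *)
Inductive polyfun : ('rV[R]_N -> R) -> Prop :=
| polyfun_cst c : polyfun (fun=> c)
| polyfun_coord i : polyfun (fun x => x 0 i)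
| polyfunD f g : polyfun f -> polyfun g -> polyfun (fun x => f x + g x)
| polyfunM f g : polyfun f -> polyfun g -> polyfun (fun x => f x * g x).

Lemma polyfun_sum (I : Type) (r : seq I) (P : pred I)
    (f : I -> 'rV[R]_N -> R) :
  (forall i, polyfun (f i)) -> polyfun (fun x => \sum_(i <- r | P i) f i x).
Proof.
move=> Pf; elim: r => [|i r IH].
  rewrite (_ : (fun=> _) = (fun=> 0)); first exact: polyfun_cst.
  by apply/funext => x; rewrite big_nil.
case: (boolP (P i)) => Pi.
  rewrite (_ : (fun=> _) = (fun x => f i x + \sum_(j <- r | P j) f j x)).
    exact: polyfunD.
  by apply/funext => x; rewrite big_cons Pi.
rewrite (_ : (fun=> _) = (fun x => \sum_(j <- r | P j) f j x)) //.
by apply/funext => x; rewrite big_cons (negbTE Pi).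
Qed.

Lemma polyfun_differentiable f x : polyfun f -> differentiable f x.
Proof.
elim=> {f} [c|i|f g _ df _ dg|f g _ df _ dg].
- exact: differentiable_cst.
- exact: differentiable_coord.
- exact: differentiableD.
- exact: differentiableM.
Qed.

Lemma polyfun_derivable f x v : polyfun f -> derivable f x v.
Proof. by move=> Pf; apply/diff_derivable/polyfun_differentiable. Qed.

(** The difference quotient along the line is exactly b + c h. The objective, and the constraints
    along directions that fix the parameters, are quadratic on lines, so their derivatives can be
    read off. *)
Lemma derive_quadratic f x v (a b c : R) :
  (forall s, f (s *: v + x) = a + b * s + c * s ^+ 2) -> 'D_v f x = b.
Proof.
move=> fE; apply: cvg_lim => //.
have fx : f x = a.
  by rewrite -[x]add0r -(scale0r v) fE mulr0 expr0n mulr0 !addr0.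
have lin : ((fun h : R => b + c * h) @ 0^' --> b + c * 0)%classic.
  apply: cvgD; first exact: cvg_cst.
  apply: cvgMl_tmp; apply: cvg_within_filter; exact: cvg_id.
move: lin; rewrite mulr0 addr0; apply: cvg_trans; apply: near_eq_cvg.
near=> h.
have h0 : h != 0 by near: h; exact: nbhs_dnbhs_neq.
rewrite /= fx fE /GRing.scale /=.
by rewrite (_ : _ - a = h * (b + c * h)) ?mulKf //; ring.
Unshelve. all: by end_near. Qed.

Lemma polyfun_derive f v : polyfun f -> polyfun ('D_v f).
Proof.
elim=> {f} [c|i|f g Pf IHf Pg IHg|f g Pf IHf Pg IHg].
- rewrite (_ : 'D_v _ = (fun=> 0)); first exact: polyfun_cst.
  by apply/funext => x; rewrite derive_cst.
- rewrite (_ : 'D_v _ = (fun=> v 0 i)); first exact: polyfun_cst.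
  apply/funext => x; apply: (@derive_quadratic _ _ _ (x 0 i) _ 0) => s.
  by rewrite !mxE mul0r addr0 addrC mulrC.
- rewrite (_ : 'D_v _ = (fun x => 'D_v f x + 'D_v g x)); first exact: polyfunD.
  by apply/funext => x; rewrite deriveD //; apply: polyfun_derivable.
- rewrite (_ : 'D_v _ = (fun x => f x * 'D_v g x + g x * 'D_v f x)).
    by apply: polyfunD; apply: polyfunM.
  by apply/funext => x; rewrite deriveM //; apply: polyfun_derivable.
Qed.

Lemma derive_lincomb n (a : 'I_n -> R) (f : 'I_n -> 'rV[R]_N -> R) x v :
  (forall j, polyfun (f j)) ->
  'D_v (fun x => \sum_j a j * f j x) x = \sum_j a j * 'D_v (f j) x.
Proof.
move=> Pf; rewrite (_ : (fun x => _) = \sum_j (a j *: f j)).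
  rewrite derive_sum => [|j]; last exact/derivableZ/polyfun_derivable.
  by apply: eq_bigr => j _; rewrite deriveZ //; apply: polyfun_derivable.
by apply/funext => z; rewrite fct_sumE.
Qed.

Lemma gradE f x v : polyfun f -> 'D_v f x = \sum_i v 0 i * grad f x 0 i.
Proof.
move=> Pf; rewrite deriveE; last exact: polyfun_differentiable.
rewrite [in LHS](row_sum_delta v) linear_sum; apply: eq_bigr => i _.
by rewrite linearZ mxE deriveE //; apply: polyfun_differentiable.
Qed.

(** Both derivatives are expanded in the basis in the order used by [hess], so symmetry of second
    derivatives does not enter. *)
Lemma hessE f x y : polyfun f ->
  (y *m hess f x *m y^T) 0 0 = 'D_y ('D_y f) x.
Proof.
move=> Pf; rewrite mxE.
rewrite (_ : 'D_y f = fun x => \sum_j y 0 j * 'D_(delta_mx 0 j) f x);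
  last first.
  apply/funext => z; rewrite gradE //.
  by apply: eq_bigr => i _; rewrite mxE.
rewrite derive_lincomb => [|j]; last exact: polyfun_derive.
apply: eq_bigr => j _; rewrite gradE; last exact: polyfun_derive.
rewrite !mxE mulrC; congr (_ * _); apply: eq_bigr => i _.
by rewrite !mxE.
Qed.

Lemma derive_translate f v t :
  'D_v (fun x => f (x - t)) = fun x => 'D_v f (x - t).
Proof.
apply/funext => x; rewrite /derive.
rewrite (_ : (fun h : R => _) = (fun h : R =>
  h^-1 *: ((f \o shift (x - t)) (h *: v) - f (x - t)))) //.
by apply/funext => h /=; rewrite addrA.
Qed.

Lemma mul_jacobianE M (c : 'rV[R]_N -> 'rV[R]_M) x y j :
  (forall j, polyfun (fun x => c x 0 j)) ->
  (y *m 'J c x) 0 j = 'D_y (fun x => c x 0 j) x.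
Proof.
move=> Pc.
have dc : differentiable c x.
  rewrite (_ : c = \sum_j (fun x => c x 0 j *: delta_mx 0 j)).
    by apply: differentiable_sum => i;
    exact/differentiableZl/polyfun_differentiable.
  by apply/funext => z; rewrite fct_sumE -row_sum_delta.
rewrite -deriveEjacobian // derive_mx ?mxE //.
exact: diff_derivable.
Qed.

Lemma jacobianE M (c : 'rV[R]_N -> 'rV[R]_M) x i j :
  (forall j, polyfun (fun x => c x 0 j)) ->
  'J c x i j = 'D_(delta_mx 0 i) (fun x => c x 0 j) x.
Proof.
move=> Pc; have <- := @mul_jacobianE M c x (delta_mx 0 i) j Pc.
by rewrite -rowE [RHS]mxE.
Qed.

End PolynomialFunctions.

(** * Euclidean norm and explicit matrix bounds *)

Section Norms.
Context (R : realType).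

Lemma sqr_norm2 N (v : 'rV[R]_N) : norm2 v ^+ 2 = \sum_i v 0 i ^+ 2.
Proof. by rewrite sqr_sqrtr // sumr_ge0 // => i _; apply: sqr_ge0. Qed.

Lemma norm2_ge0 N (v : 'rV[R]_N) : 0 <= norm2 v.
Proof. exact: sqrtr_ge0. Qed.

Lemma norm2_eq0 N (v : 'rV[R]_N) : (norm2 v == 0) = (v == 0).
Proof.
apply/eqP/eqP => [v0|->]; last first.
  by rewrite /norm2 big1 ?sqrtr0 // => i _; rewrite mxE expr0n.
have /eqP : \sum_i v 0 i ^+ 2 = 0 by rewrite -sqr_norm2 v0 expr0n.
rewrite psumr_eq0 => [/allP vi0|i _]; last exact: sqr_ge0.
apply/rowP => i; rewrite mxE.
by have := vi0 i (mem_index_enum _); rewrite sqrf_eq0 => /eqP.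
Qed.

Lemma ler_norm2_coord N (v : 'rV[R]_N) i : `|v 0 i| <= norm2 v.
Proof.
rewrite -(@ler_pXn2r _ 2) ?nnegrE ?norm2_ge0 // sqr_norm2.
rewrite real_normK ?num_real //.
by rewrite (bigD1 i) //= lerDl sumr_ge0 // => j _; apply: sqr_ge0.
Qed.

Lemma norm2_le_sum N (v : 'rV[R]_N) : norm2 v <= \sum_i `|v 0 i|.
Proof.
have s0 : 0 <= \sum_i `|v 0 i| by apply: sumr_ge0.
rewrite -(@ler_pXn2r _ 2) ?nnegrE ?norm2_ge0 // sqr_norm2 expr2 mulr_suml.
apply: ler_sum => i _; rewrite -real_normK ?num_real // expr2.
rewrite ler_wpM2l // (bigD1 i) //= lerDl; exact: sumr_ge0.
Qed.

(** The entrywise l1 norm bounds both the operator norm and the quadratic form of a matrix, which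
    keeps all constants explicit. *)
Definition norm1_mx m n (M : 'M[R]_(m, n)) : R := \sum_i \sum_j `|M i j|.

Lemma norm1_mx_ge0 m n (M : 'M[R]_(m, n)) : 0 <= norm1_mx M.
Proof. by apply: sumr_ge0 => i _; apply: sumr_ge0. Qed.

Lemma norm2_mul_le m n (u : 'rV[R]_m) (M : 'M[R]_(m, n)) :
  norm2 (u *m M) <= norm2 u * norm1_mx M.
Proof.
apply: le_trans (norm2_le_sum _) _.
rewrite /norm1_mx exchange_big mulr_sumr; apply: ler_sum => j _.
rewrite mxE mulr_sumr; apply: le_trans (ler_norm_sum _ _ _) _.
by apply: ler_sum => i _; rewrite normrM ler_wpM2r // ler_norm2_coord.
Qed.

Lemma quadratic_form_le m (u : 'rV[R]_m) (M : 'M[R]_m) :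
  `|(u *m M *m u^T) 0 0| <= norm2 u ^+ 2 * norm1_mx M.
Proof.
rewrite mxE /norm1_mx exchange_big mulr_sumr.
apply: le_trans (ler_norm_sum _ _ _) _; apply: ler_sum => j _.
rewrite !mxE mulr_suml mulr_sumr.
apply: le_trans (ler_norm_sum _ _ _) _; apply: ler_sum => i _.
rewrite !normrM mulrAC expr2.
by rewrite ler_wpM2r // ler_pM // ler_norm2_coord.
Qed.

End Norms.

(** * Common divisors of polynomial matrices *)

Section CommonDivisors.
Context (R : realType) (n : nat).
Implicit Types (g h r : {poly R}) (F M : 'M[{poly R}]_n).

Lemma max_common_divisor_dvd g h M : h != 0 ->
  max_common_divisor h M -> common_divisor g M -> g %| h.
Proof.
move=> h0 [hM hmax] gM.
have [g0|g0] := eqVneq g 0.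
  have M0 i j : M i j = 0 by apply/eqP; rewrite -dvd0p -g0.
  (* All entries are 0 here, so [h * 'X] is a common divisor of larger degree. *)
  have /hmax : common_divisor (h * 'X) M by move=> i j; rewrite M0 dvdp0.
  by rewrite size_mulX // ltnn.
pose c := gcdp h g; pose q1 := h %/ c; pose q2 := g %/ c.
have c0 : c != 0 by rewrite gcdp_eq0 negb_and h0.
have hE : h = q1 * c by rewrite divpK // dvdp_gcdl.
have gE : g = q2 * c by rewrite divpK // dvdp_gcdr.
have q2_0 : q2 != 0 by apply: contraNneq g0 => q20; rewrite gE q20 mul0r.
have co : coprimep q2 q1.
  by rewrite coprimep_sym coprimep_div_gcd // h0.
(* [h * q2] is the lcm of [g] and [h]. By maximality of [h] the factor [q2] is constant, hence [g]
   is associated to the gcd [c]. *)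
have lM : common_divisor (h * q2) M.
  move=> i j; have /dvdpP[f fE] := hM i j; have /dvdpP[f' f'E] := gM i j.
  rewrite fE mulrC dvdp_mul2r // -(Gauss_dvdpr _ co).
  apply/dvdpP; exists f'; apply: (mulIf c0).
  by rewrite -[in RHS]mulrA -gE -f'E fE {1}hE; ring.
have := hmax _ lM; rewrite size_mul // => sz.
have : (size q2 <= 1)%N.
  move: sz; rewrite -subn1 -addnBA ?size_poly_gt0 // -[X in (_ <= X)%N]addn0.
  by rewrite leq_add2l leqn0 subn_eq0.
move=> /size1_polyC q2C.
rewrite gE q2C mul_polyC dvdpZl ?dvdp_gcdl //.
by move: q2_0; rewrite {1}q2C polyC_eq0.
Qed.

Lemma max_common_divisor_monic_unique g h M :
  g \is monic -> h \is monic ->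
  max_common_divisor g M -> max_common_divisor h M -> g = h.
Proof.
move=> gm hm gM hM.
have gh : g %| h.
  exact: max_common_divisor_dvd (monic_neq0 hm) hM gM.1.
have hg : h %| g.
  exact: max_common_divisor_dvd (monic_neq0 gm) gM hM.1.
by apply/eqP; rewrite -eqp_monic // /eqp gh.
Qed.

(* The entries of the cofactor of a gcd have no common factor, so a factor of *)
(* [h] that [r] lacks would have to divide all of [F], contradicting          *)
(* maximality.                                                                *)
Lemma max_common_divisor_cofactor h r F : h != 0 ->
  max_common_divisor h (h *: F) -> (forall i j, h %| r * F i j) -> h %| r.
Proof.
move=> h0 hM hrF.
pose c := gcdp h r; pose q := h %/ c; pose s := r %/ c.
have c0 : c != 0 by rewrite gcdp_eq0 negb_and h0.
have hE : h = q * c by rewrite divpK // dvdp_gcdl.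
have rE : r = s * c by rewrite divpK // dvdp_gcdr.
have co : coprimep q s by rewrite coprimep_div_gcd // h0.
have qhM : common_divisor (q * h) (h *: F).
  move=> i j; rewrite mxE mulrC dvdp_mul2l //.
  rewrite -(Gauss_dvdpr _ co) -(@dvdp_mul2r _ c) // -hE.
  by rewrite mulrAC -rE.
have := max_common_divisor_dvd h0 hM qhM.
rewrite -{2}[h]mul1r dvdp_mul2r // dvdp1 size_poly_eq1 => q1.
have := eqp_mulr c q1; rewrite mul1r -hE => hc.
by rewrite (eqp_dvdl _ hc) dvdp_gcdr.
Qed.

End CommonDivisors.

(** * Coefficient vectors *)

Section Vectorization.
Context (R : realType) (n b : nat).
Implicit Types (M : 'M[{poly R}]_n) (v : 'rV[R]_(n * n * b)).

Definition coef_index (i j : 'I_n) (l : 'I_b) : 'I_(n * n * b) :=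
  mxvec_index (mxvec_index i j) l.

Variant coef_index_spec : 'I_(n * n * b) -> Prop :=
  CoefIndex i j l : coef_index_spec (coef_index i j l).

Lemma coef_indexP r : coef_index_spec r.
Proof. by case/mxvec_indexP: r => r l; case/mxvec_indexP: r => i j. Qed.

Lemma sum_coef_index (V : nmodType) (F : 'I_(n * n * b) -> V) :
  \sum_r F r = \sum_i \sum_j \sum_l F (coef_index i j l).
Proof.
rewrite (reindex _ (curry_mxvec_bij _ _)) /=.
rewrite (eq_bigr (fun p => F (mxvec_index p.1 p.2))) => [|[]//].
rewrite -(pair_bigA _ (fun r l => F (mxvec_index r l))) /=.
rewrite (reindex _ (curry_mxvec_bij _ _)) /=.
rewrite (eq_bigr (fun p => \sum_l F (coef_index p.1 p.2 l))) => [|[]//].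
by rewrite -(pair_bigA _ (fun i j => \sum_l F (coef_index i j l))).
Qed.

Lemma vec_mxpolyE M i j l : vec_mxpoly b M 0 (coef_index i j l) = (M i j)`_l.
Proof. by rewrite mxvecE !mxE mxvecE. Qed.

Lemma coef_mxpoly_vec v i j (l : 'I_b) :
  (mxpoly_vec v i j)`_l = v 0 (coef_index i j l).
Proof. by rewrite !mxE coef_rVpoly_ord !mxE. Qed.

Lemma size_mxpoly_vec v i j : (size (mxpoly_vec v i j) <= b)%N.
Proof. by rewrite !mxE size_poly. Qed.

Lemma mxpoly_vecK : cancel (@mxpoly_vec R n b) (@vec_mxpoly R n b).
Proof.
move=> v; apply/rowP => r; case: (coef_indexP r) => i j l.
by rewrite vec_mxpolyE coef_mxpoly_vec.
Qed.

Lemma vec_mxpolyK M : (forall i j, size (M i j) <= b)%N ->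
  mxpoly_vec (vec_mxpoly b M) = M.
Proof.
move=> Mb; apply/matrixP => i j; apply/polyP => l.
have [lb|bl] := ltnP l b.
  by rewrite (coef_mxpoly_vec _ _ _ (Ordinal lb)) vec_mxpolyE.
by rewrite !nth_default // (leq_trans _ bl) // size_mxpoly_vec.
Qed.

Lemma vec_mxpoly_linear c M M' :
  vec_mxpoly b (c%:P *: M + M') = c *: vec_mxpoly b M + vec_mxpoly b M'.
Proof.
apply/rowP => r; case: (coef_indexP r) => i j l.
rewrite [RHS]mxE [X in _ = X + _]mxE !vec_mxpolyE.
by rewrite !mxE coefD mul_polyC coefZ.
Qed.

Lemma vec_mxpolyD M M' :
  vec_mxpoly b (M + M') = vec_mxpoly b M + vec_mxpoly b M'.
Proof. by have := vec_mxpoly_linear 1 M M'; rewrite !scale1r. Qed.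

Lemma vec_mxpoly0 : vec_mxpoly b (0 : 'M[{poly R}]_n) = 0.
Proof.
apply/rowP => r; case: (coef_indexP r) => i j l.
by rewrite vec_mxpolyE [in RHS]mxE mxE coef0.
Qed.

Lemma vec_mxpolyZ c M : vec_mxpoly b (c%:P *: M) = c *: vec_mxpoly b M.
Proof. by rewrite -[_ *: M]addr0 vec_mxpoly_linear vec_mxpoly0 addr0. Qed.

Lemma mxpoly_vec_linear c v v' :
  mxpoly_vec (c *: v + v') = c%:P *: mxpoly_vec v + mxpoly_vec v'.
Proof.
have sz i j :
    (size ((c%:P *: mxpoly_vec v + mxpoly_vec v')%R i j) <= b)%N.
  rewrite !mxE mul_polyC.
  apply: leq_trans (size_polyD _ _) _; rewrite geq_max size_poly andbT.
  exact: leq_trans (size_scale_leq _ _) (size_poly _ _).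
by rewrite -[RHS]vec_mxpolyK // vec_mxpoly_linear !mxpoly_vecK.
Qed.

End Vectorization.

(** Padding with zero coefficients does not change the sum of squares; the index set no longer
    varies with the sizes of the entries. *)
Lemma normF_vec (R : realType) (n d : nat) (M : 'M[{poly R}]_n) :
  degmx_le d M -> normF M = norm2 (vec_mxpoly d.+1 M).
Proof.
move=> Md; congr Num.sqrt; rewrite sum_coef_index.
apply: eq_bigr => i _; apply: eq_bigr => j _.
rewrite (big_ord_widen _ (fun l => (M i j)`_l ^+ 2) (Md i j)).
rewrite big_mkcond; apply: eq_bigr => l _; rewrite vec_mxpolyE.
by case: ltnP => // /(nth_default 0) ->; rewrite expr0n.
Qed.

(** * Polynomials whose coefficients are polynomial functions of the variables *)

Section PolynomialValued.
Context (R : realType) (N : nat).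
Implicit Types P Q : 'rV[R]_N -> {poly R}.

Definition coef_polyfun P := forall l, polyfun (fun x => (P x)`_l).

Lemma coef_polyfun_cst (p : {poly R}) : coef_polyfun (fun=> p).
Proof. by move=> l; apply: polyfun_cst. Qed.

Lemma coef_polyfun_polyC (f : 'rV[R]_N -> R) :
  polyfun f -> coef_polyfun (fun x => (f x)%:P).
Proof.
move=> Pf l.
rewrite (_ : (fun _ => _) = fun x => f x * (l == 0%N)%:R).
  exact: polyfunM Pf (polyfun_cst _ _).
by apply/funext => x; rewrite coefC; case: eqP; rewrite ?mulr1 ?mulr0.
Qed.

Lemma coef_polyfunD P Q : coef_polyfun P -> coef_polyfun Q ->
  coef_polyfun (fun x => P x + Q x).
Proof.
move=> hP hQ l.
rewrite (_ : (fun _ => _) = fun x => (P x)`_l + (Q x)`_l).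
  exact: polyfunD.
by apply/funext => x; rewrite coefD.
Qed.

Lemma coef_polyfunM P Q : coef_polyfun P -> coef_polyfun Q ->
  coef_polyfun (fun x => P x * Q x).
Proof.
move=> hP hQ l.
rewrite (_ : (fun _ => _) =
  fun x => \sum_(i < l.+1) (P x)`_i * (Q x)`_(l - i)).
  by apply: polyfun_sum => i; apply: polyfunM.
by apply/funext => x; rewrite coefM.
Qed.

Lemma coef_polyfunN P : coef_polyfun P -> coef_polyfun (fun x => - P x).
Proof.
move=> hP; rewrite (_ : (fun _ => _) = fun x => -1 * P x).
  exact: coef_polyfunM (coef_polyfun_cst _) hP.
by apply/funext => x; rewrite mulN1r.
Qed.

Lemma coef_polyfun_sum (I : Type) (r : seq I) (A : pred I)
    (P : I -> 'rV[R]_N -> {poly R}) :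
  (forall i, coef_polyfun (P i)) ->
  coef_polyfun (fun x => \sum_(i <- r | A i) P i x).
Proof.
move=> hP l.
rewrite (_ : (fun _ => _) = fun x => \sum_(i <- r | A i) (P i x)`_l).
  by apply: polyfun_sum => i; apply: hP.
by apply/funext => x; rewrite coef_sum.
Qed.

Lemma coef_polyfun_prod (I : Type) (r : seq I) (P : I -> 'rV[R]_N -> {poly R}) :
  (forall i, coef_polyfun (P i)) ->
  coef_polyfun (fun x => \prod_(i <- r) P i x).
Proof.
move=> hP; elim: r => [|i r IH].
  rewrite (_ : (fun _ => _) = fun=> 1); first exact: coef_polyfun_cst.
  by apply/funext => x; rewrite big_nil.
rewrite (_ : (fun _ => _) = fun x => P i x * \prod_(j <- r) P j x).
  exact: coef_polyfunM.
by apply/funext => x; rewrite big_cons.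
Qed.

Lemma coef_polyfun_rVpoly b (f : 'rV[R]_N -> 'rV[R]_b) :
  (forall i, polyfun (fun x => f x 0 i)) ->
  coef_polyfun (fun x => rVpoly (f x)).
Proof.
move=> hf l; have [lb|bl] := ltnP l b.
  rewrite (_ : (fun _ => _) = fun x => f x 0 (Ordinal lb)) //.
  by apply/funext => x; rewrite -coef_rVpoly_ord.
rewrite (_ : (fun _ => _) = fun=> 0); first exact: polyfun_cst.
by apply/funext => x; rewrite nth_default // (leq_trans _ bl) // size_poly.
Qed.

Lemma coef_polyfun_det n (M : 'rV[R]_N -> 'M[{poly R}]_n) :
  (forall i j, coef_polyfun (fun x => M x i j)) ->
  coef_polyfun (fun x => \det (M x)).
Proof.
move=> hM; apply: coef_polyfun_sum => s; apply: coef_polyfunM.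
  exact: coef_polyfun_cst.
exact: coef_polyfun_prod.
Qed.

Lemma coef_polyfun_adj n (M : 'rV[R]_N -> 'M[{poly R}]_n) :
  (forall i j, coef_polyfun (fun x => M x i j)) ->
  forall i j, coef_polyfun (fun x => (\adj (M x)) i j).
Proof.
move=> hM i j.
rewrite (_ : (fun _ => _) =
  fun x => (-1) ^+ (j + i) * \det (row' j (col' i (M x)))).
  apply: coef_polyfunM; first exact: coef_polyfun_cst.
  apply: coef_polyfun_det => p q.
  rewrite (_ : (fun _ => _) = fun x => M x (lift j p) (lift i q)) //.
  by apply/funext => x; rewrite !mxE.
by apply/funext => x; rewrite mxE.
Qed.

End PolynomialValued.

(** * Derivatives of the objective and the constraints *)

Section Problem.
Context (R : realType) (n d m k : nat).
Implicit Types (A B E : 'M[{poly R}]_n) (S : 'I_k -> 'M[{poly R}]_n).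
Implicit Types x y v : 'rV[R]_(nvars n d m k).

(** The linear part of [pert_vec]. The zero block belongs to the coefficients of F and h, which do
    not move the perturbation. *)
Definition direction_mx S : 'M[R]_(nvars n d m k, n * n * d.+1) :=
  col_mx (\matrix_i vec_mxpoly d.+1 (S i)) 0.

Lemma vec_affine_mx b E S (p : 'rV[R]_k) :
  vec_mxpoly b (affine_mx E S p) =
  vec_mxpoly b E + p *m \matrix_i vec_mxpoly b (S i).
Proof.
rewrite vec_mxpolyD mulmx_sum_row; congr (_ + _).
rewrite (big_morph _ (@vec_mxpolyD R n b) (@vec_mxpoly0 R n b)).
by apply: eq_bigr => i _; rewrite vec_mxpolyZ rowK.
Qed.

Lemma degmx_affine_mx E S (p : 'rV[R]_k) :
  degmx_le d E -> (forall i, degmx_le d (S i)) ->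
  degmx_le d (affine_mx E S p).
Proof.
move=> Ed Sd i j; rewrite mxE summxE.
apply: leq_trans (size_polyD _ _) _; rewrite geq_max Ed /=.
apply: leq_trans (size_sum _ _ _) _; apply/bigmax_leqP => l _.
by rewrite mxE mul_polyC (leq_trans (size_scale_leq _ _)) // Sd.
Qed.

Lemma mul_direction_mx S y :
  y *m direction_mx S = lsubmx y *m \matrix_i vec_mxpoly d.+1 (S i).
Proof. by rewrite -{1}[y]hsubmxK mul_row_col mulmx0 addr0. Qed.

Lemma direction_mx_eq0 S y :
  (forall i, degmx_le d (S i)) -> free_directions S ->
  y *m direction_mx S = 0 -> lsubmx y = 0.
Proof.
move=> Sd Sfree; rewrite mul_direction_mx => y0; apply: Sfree.
have d0 : degmx_le d (0 : 'M[{poly R}]_n).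
  by move=> i j; rewrite mxE size_poly0.
rewrite -[LHS](vec_mxpolyK (degmx_affine_mx (lsubmx y) d0 Sd)).
rewrite vec_affine_mx vec_mxpoly0 add0r y0.
by rewrite -(vec_mxpoly0 R n d.+1) vec_mxpolyK.
Qed.

Definition pert_vec E S x : 'rV[R]_(n * n * d.+1) :=
  vec_mxpoly d.+1 (pert E S x).

Lemma pert_vec_line E S x y s :
  pert_vec E S (s *: y + x) = s *: (y *m direction_mx S) + pert_vec E S x.
Proof.
rewrite /pert_vec /pert !vec_affine_mx /var_param linearP mulmxDl -scalemxAl.
by rewrite mul_direction_mx addrCA.
Qed.

Section Objective.
Variables (E : 'M[{poly R}]_n) (S : 'I_k -> 'M[{poly R}]_n).
Hypotheses (Ed : degmx_le d E) (Sd : forall i, degmx_le d (S i)).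

Lemma normF_pert x : normF (pert E S x) = norm2 (pert_vec E S x).
Proof. by rewrite (normF_vec (degmx_affine_mx _ Ed Sd)). Qed.

Lemma objectiveE x : objective E S x = \sum_r pert_vec E S x 0 r ^+ 2.
Proof. by rewrite /objective normF_pert sqr_norm2. Qed.

Lemma polyfun_objective : polyfun (@objective R n d m k E S).
Proof.
rewrite (_ : @objective R n d m k E S =
  fun x => \sum_r pert_vec E S x 0 r * pert_vec E S x 0 r); last first.
  apply/funext => x; rewrite objectiveE.
  by apply: eq_bigr => r _; rewrite expr2.
apply: polyfun_sum => r.
have pr : polyfun (fun x => pert_vec E S x 0 r).
  rewrite (_ : (fun _ => _) = fun x => vec_mxpoly d.+1 E 0 r +
      \sum_i x 0 i * direction_mx S i r).
    apply: polyfunD; first exact: polyfun_cst.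
    by apply: polyfun_sum => i; apply/polyfunM/polyfun_cst/polyfun_coord.
  apply/funext => x; rewrite /pert_vec /pert vec_affine_mx -mul_direction_mx.
  by rewrite mxE [X in _ + X]mxE.
exact: polyfunM.
Qed.

Lemma derive_objective x v :
  'D_v (@objective R n d m k E S) x =
  2 * \sum_r pert_vec E S x 0 r * (v *m direction_mx S) 0 r.
Proof.
apply: (@derive_quadratic _ _ _ _ _ (\sum_r pert_vec E S x 0 r ^+ 2) _
  (\sum_r (v *m direction_mx S) 0 r ^+ 2)) => s.
rewrite objectiveE pert_vec_line mulrAC mulr_sumr mulr_suml -!big_split /=.
by apply: eq_bigr => r _; rewrite !mxE; ring.
Qed.

Lemma derive2_objective x v :
  'D_v ('D_v (@objective R n d m k E S)) x =
  2 * norm2 (v *m direction_mx S) ^+ 2.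
Proof.
rewrite (_ : 'D_v (@objective R n d m k E S) = fun x =>
  2 * \sum_r pert_vec E S x 0 r * (v *m direction_mx S) 0 r); last first.
  by apply/funext => z; rewrite derive_objective.
apply: (@derive_quadratic _ _ _ _ _
  (2 * \sum_r pert_vec E S x 0 r * (v *m direction_mx S) 0 r) _ 0) => s.
rewrite mul0r addr0 -mulrA -mulrDr sqr_norm2 pert_vec_line; congr (2 * _).
rewrite mulr_suml -big_split /=; apply: eq_bigr => r _.
by rewrite mxE [X in X + _]mxE; ring.
Qed.

Lemma grad_objective x :
  grad (@objective R n d m k E S) x =
  2 *: (pert_vec E S x *m (direction_mx S)^T).
Proof.
apply/rowP => i; rewrite mxE derive_objective mxE mxE; congr (2 * _).
by apply: eq_bigr => r _; rewrite -rowE !mxE.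
Qed.

End Objective.

(** * The constraints as polynomial functions, and their translation *)

Lemma var_h_line x y s : var_h (s *: y + x) = s%:P * var_h y + var_h x.
Proof. by rewrite /var_h !linearP /= mul_polyC. Qed.

Lemma var_F_line x y s : var_F (s *: y + x) = s%:P *: var_F y + var_F x.
Proof. by rewrite /var_F !linearP /= mxpoly_vec_linear. Qed.

Lemma normalizedE (h : {poly R}) : normalized m h 0 0 = h`_m.
Proof. by rewrite /normalized -rowE !mxE. Qed.

Lemma constraints_lshift A E S x (r : 'I_(n * n * adj_size n d)) :
  constraints A E S x 0 (lshift 1 r) =
  vec_mxpoly (adj_size n d) (\adj (A + pert E S x) - var_h x *: var_F x) 0 r.
Proof. exact: row_mxEl. Qed.

Lemma constraints_rshift A E S x (r : 'I_1) :
  constraints A E S x 0 (rshift (n * n * adj_size n d) r) = (var_h x)`_m - 1.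
Proof. by rewrite row_mxEr [r]ord1 !mxE -normalizedE /normalized !mxE. Qed.

Lemma polyfun_constraints A E S j :
  polyfun (fun x => constraints A E S x 0 j).
Proof.
have hh : coef_polyfun (@var_h R n d m k).
  apply: coef_polyfun_rVpoly => i.
  rewrite (_ : (fun _ => _) =
    fun x => x 0 (rshift k (rshift (n * n * cof_size n d m) i))).
    exact: polyfun_coord.
  by apply/funext => x; rewrite !mxE.
case: (split_ordP j) => r ->; last first.
  rewrite (_ : (fun _ => _) = fun x => (var_h x)`_m + -1).
    by apply: polyfunD (polyfun_cst _ _); apply: hh.
  by apply/funext => x; rewrite constraints_rshift.
case: (coef_indexP r) => a b l.
rewrite (_ : (fun _ => _) =
  fun x => (\adj (A + pert E S x) a b + - (var_h x * var_F x a b))`_l).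
  apply: coef_polyfunD.
    apply: (coef_polyfun_adj (M := fun x => A + pert E S x)) => p q.
    rewrite (_ : (fun _ => _) =
      fun x => (A + E) p q + \sum_i (x 0 (lshift _ i))%:P * S i p q).
      apply: coef_polyfunD; first exact: coef_polyfun_cst.
      apply: coef_polyfun_sum => i; apply/coef_polyfunM/coef_polyfun_cst.
      exact/coef_polyfun_polyC/polyfun_coord.
    apply/funext => x; rewrite /pert /affine_mx addrA mxE summxE.
    by congr (_ + _); apply: eq_bigr => i _; rewrite !mxE.
  apply/coef_polyfunN/coef_polyfunM => //.
  rewrite (_ : (fun _ => _) = fun x =>
      rVpoly (row (mxvec_index a b) (vec_mx (lsubmx (rsubmx x))))); last first.
    by apply/funext => x; rewrite !mxE.
  apply: coef_polyfun_rVpoly => i.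
  rewrite (_ : (fun _ => _) = fun x =>
      x 0 (rshift k (lshift m.+1 (coef_index a b i)))).
    exact: polyfun_coord.
  by apply/funext => x; rewrite !mxE.
by apply/funext => x; rewrite constraints_lshift vec_mxpolyE !mxE.
Qed.

(** Only the parameters are shifted: the matrix under the adjugate is the same on both sides, and h
    and F are untouched. *)
Lemma constraints_translate A E S x x' :
  constraints A E S x' =
  constraints (A + pert E S x) 0 S (x' - row_mx (lsubmx x) 0).
Proof.
set x0 := x' - _.
have rE : rsubmx x0 = rsubmx x' by rewrite linearB /= row_mxKr subr0.
have hE : var_h x0 = var_h x' by rewrite /var_h rE.
have FE : var_F x0 = var_F x' by rewrite /var_F rE.
have pE : A + pert E S x + pert 0 S x0 = A + pert E S x'.
  rewrite /pert /affine_mx /var_param linearB /= row_mxKl add0r -!addrA.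
  rewrite -big_split /=; congr (_ + (_ + _)); apply: eq_bigr => i _.
  rewrite -scalerDl -polyCD !mxE. by rewrite subrKC.
by rewrite /constraints hE FE pE.
Qed.

Lemma lagrangianE A E S lam x :
  lagrangian A E S x lam =
  objective E S x + \sum_j lam 0 j * constraints A E S x 0 j.
Proof.
by rewrite /lagrangian mxE; congr (_ + _); apply: eq_bigr => j _; rewrite mxE.
Qed.

Section Lagrangian.
Variables (A E : 'M[{poly R}]_n) (S : 'I_k -> 'M[{poly R}]_n).
Hypotheses (Ed : degmx_le d E) (Sd : forall i, degmx_le d (S i)).

Lemma polyfun_lagrangian lam :
  polyfun (fun x => lagrangian (m := m) (k := k) A E S x lam).
Proof.
rewrite (_ : (fun _ => _) = fun x => objective E S x +
    \sum_j lam 0 j * constraints A E S x 0 j).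
  apply: polyfunD; first exact: polyfun_objective.
  apply: polyfun_sum => j.
  exact: polyfunM (polyfun_cst _ _) (polyfun_constraints _ _ _ _).
by apply/funext => x; rewrite lagrangianE.
Qed.

Lemma derive_lagrangian lam v x :
  'D_v (fun x => lagrangian A E S x lam) x =
  'D_v (@objective R n d m k E S) x +
  \sum_j lam 0 j * 'D_v (fun x => constraints A E S x 0 j) x.
Proof.
have Pc j := polyfun_constraints A E S j.
rewrite (_ : (fun x => lagrangian A E S x lam) = (objective E S +
    (fun x => \sum_j lam 0 j * constraints A E S x 0 j))%R).
  have dO : derivable (@objective R n d m k E S) x v.
    exact/polyfun_derivable/polyfun_objective.
  have Ps : polyfun (fun x => \sum_j lam 0 j * constraints A E S x 0 j).
    by apply: polyfun_sum => j; apply: polyfunM (polyfun_cst _ _) (Pc j).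
  rewrite (deriveD dO (polyfun_derivable Ps)).
  by congr (_ + _); apply: derive_lincomb.
by apply/funext => z; rewrite lagrangianE.
Qed.

Lemma derive2_lagrangian lam v x :
  'D_v ('D_v (fun x => lagrangian A E S x lam)) x =
  2 * norm2 (v *m direction_mx S) ^+ 2 +
  \sum_j lam 0 j * 'D_v ('D_v (fun x => constraints A E S x 0 j)) x.
Proof.
have Pc j := polyfun_derive v (polyfun_constraints A E S j).
rewrite (_ : 'D_v (fun x => lagrangian A E S x lam) =
  ('D_v (@objective R n d m k E S) +
  (fun x => \sum_j lam 0 j * 'D_v (fun x => constraints A E S x 0 j) x))%R).
  have dO : derivable ('D_v (@objective R n d m k E S)) x v.
    exact/polyfun_derivable/polyfun_derive/polyfun_objective.
  have Ps : polyfun (fun x =>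
      \sum_j lam 0 j * 'D_v (fun x => constraints A E S x 0 j) x).
    by apply: polyfun_sum => j; apply: polyfunM (polyfun_cst _ _) (Pc j).
  rewrite (deriveD dO (polyfun_derivable Ps)) (derive2_objective Ed Sd).
  by congr (_ + _); apply: derive_lincomb.
by apply/funext => z; rewrite derive_lagrangian.
Qed.

Lemma grad_lagrangian lam x :
  grad (fun x => lagrangian A E S x lam) x =
  grad (@objective R n d m k E S) x + lam *m ('J (constraints A E S) x)^T.
Proof.
apply/rowP => i; rewrite [RHS]mxE [in LHS]mxE derive_lagrangian mxE.
congr (_ + _); rewrite mxE; apply: eq_bigr => j _; congr (_ * _).
by rewrite mxE jacobianE // => i'; apply: polyfun_constraints.
Qed.

(** The Lagrangian is affine in [lam], so this gradient does not depend on [lam]: the second clause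
    of [multipliers] passes from one vector to any other. *)
Lemma grad_lagrangian_multiplier lam x :
  grad (lagrangian A E S x) lam = constraints A E S x.
Proof.
apply/rowP => j; rewrite mxE.
apply: (@derive_quadratic _ _ _ _ _ (lagrangian A E S x lam) _ 0) => s.
rewrite mul0r addr0 !lagrangianE -addrA; congr (_ + _).
under eq_bigr => i _.
  rewrite [_ 0 i]mxE [X in X + _]mxE mulrDl -mulrA; over.
rewrite big_split /= -mulr_sumr addrC mulrC; congr (_ + _ * _).
rewrite (bigD1 j) //= mxE !eqxx mul1r big1 ?addr0 // => i ij.
by rewrite mxE (negbTE ij) andbF mul0r.
Qed.

End Lagrangian.

(** * The kernel of the Jacobian at a gcd factorization *)

Lemma size_var_h x : (size (var_h x) <= m.+1)%N.
Proof. exact: size_poly. Qed.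

Lemma size_mul_var (p : {poly R}) x i j : (size p <= m.+1)%N ->
  (size (p * var_F x i j)%R <= adj_size n d)%N.
Proof.
(* [cof_size] is a truncated subtraction; a non-zero entry forces it to be positive, and then the
   two size bounds add up to [adj_size]. *)
move=> pm; have [->|F0] := eqVneq (var_F x i j) 0.
  by rewrite mulr0 size_poly0.
have Fs : (size (var_F x i j) <= cof_size n d m)%N by exact: size_mxpoly_vec.
have s0 : (0 < size (var_F x i j))%N by rewrite size_poly_gt0.
apply: leq_trans (size_polyMleq _ _) _.
move: Fs s0 pm; rewrite /cof_size; lia.
Qed.

(** Differentiating the factorization with [B] fixed gives F dh + h dF = 0. Since h is the gcd, it
    divides dh, while the normalization makes dh of degree below m; so dh vanishes, and then dF
    does. *)
Lemma constraints_kernel_eq0 B S z y :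
  lsubmx z = 0 -> \adj B = var_h z *: var_F z ->
  normalized m (var_h z) = 1%:M ->
  max_common_divisor (var_h z) (\adj B) ->
  y *m 'J (constraints B 0 S) z = 0 -> lsubmx y = 0 -> y = 0.
Proof.
move=> z0 Bz hz hmax yJ y0.
have D0 j : 'D_y (fun x => constraints B 0 S x 0 j) z = 0.
  by rewrite -mul_jacobianE ?yJ ?mxE // => i; apply: polyfun_constraints.
have p0 s : pert 0 S (s *: y + z) = 0.
  rewrite /pert /var_param linearP /= y0 z0 scaler0 addr0 /affine_mx add0r.
  by rewrite big1 // => i _; rewrite mxE scale0r.
have hm : (var_h z)`_m = 1 by rewrite -normalizedE hz mxE.
have h0 : var_h z != 0.
  by apply: contra_eq_neq hm => ->; rewrite coef0 eq_sym oner_neq0.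
have gm : (var_h y)`_m = 0.
  apply: etrans (D0 (rshift _ ord0)); apply/esym.
  apply: (@derive_quadratic _ _ _ _ _ ((var_h z)`_m - 1) _ 0) => s.
  rewrite constraints_rshift var_h_line coefD mul_polyC coefZ; ring.
have addE (a b : {poly R}) (M M' : 'M[{poly R}]_n) i j :
  (a *: M + b *: M') i j = a * M i j + b * M' i j by rewrite !mxE.
have lineE (a : {poly R}) (M M' : 'M[{poly R}]_n) i j :
  (a *: M + M') i j = a * M i j + M' i j by rewrite !mxE.
have subE (a : {poly R}) (M M' : 'M[{poly R}]_n) i j :
  (M - a *: M') i j = M i j - a * M' i j by rewrite !mxE.
have FE : var_h y *: var_F z + var_h z *: var_F y = 0.
  have sz i j : (size ((var_h y *: var_F z + var_h z *: var_F y)%R i j) <=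
      adj_size n d)%N.
    rewrite addE; apply: leq_trans (size_polyD _ _) _.
    by rewrite geq_max !size_mul_var ?size_var_h.
  apply/matrixP => i j; apply/polyP => l; rewrite [in RHS]mxE coef0.
  have [ls|ls] := ltnP l (adj_size n d); last first.
    by rewrite nth_default // (leq_trans (sz i j)).
  rewrite addE -[LHS]opprK -[RHS]oppr0; congr (- _).
  apply: etrans (D0 (lshift 1 (coef_index i j (Ordinal ls)))); apply/esym.
  (* The adjugate is constant along this line, so only the product of h and F varies, and it is
     quadratic in [s]. *)
  apply: (@derive_quadratic _ _ _ _ _
    ((\adj B - var_h z *: var_F z) i j)`_l _
    (- (var_h y * var_F y i j)`_l)) => s.
  rewrite constraints_lshift p0 addr0 vec_mxpolyE /=.
  rewrite var_h_line var_F_line !subE lineE.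
  rewrite (_ : (s%:P * var_h y + var_h z) *
      (s%:P * var_F y i j + var_F z i j) =
    s%:P * s%:P * (var_h y * var_F y i j) +
    s%:P * (var_h y * var_F z i j + var_h z * var_F y i j) +
    var_h z * var_F z i j); last by ring.
  rewrite -polyCM !coefB !coefD !mul_polyC !coefZ coefD; ring.
have dvd i j : var_h z %| var_h y * var_F z i j.
  have /matrixP/(_ i j) := FE; rewrite addE [RHS]mxE => /eqP.
  by rewrite addr_eq0 => /eqP ->; rewrite dvdpNr dvdp_mulr.
rewrite Bz in hmax.
have hg : var_h z %| var_h y := max_common_divisor_cofactor h0 hmax dvd.
have szh : size (var_h z) = m.+1.
  apply/eqP; rewrite eqn_leq size_var_h ltnNge; apply/negP => sh.
  by move: hm; rewrite nth_default // => /esym/eqP; rewrite oner_eq0.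
have szg : (size (var_h y) <= m)%N.
  apply/leq_sizeP => j; rewrite leq_eqVlt => /orP[/eqP <- //|mj].
  by rewrite nth_default // (leq_trans (size_var_h _)).
have g0 : var_h y = 0.
  apply: contraTeq hg => g0; rewrite gtNdvdp ?szh ?ltnS //.
have Fy0 : var_F y = 0.
  apply/matrixP => i j; apply: (mulfI h0).
  by have /matrixP/(_ i j) := FE; rewrite addE g0 mul0r add0r => ->;
    rewrite !mxE mulr0.
rewrite -[y]hsubmxK y0 -[rsubmx y]hsubmxK.
rewrite -[lsubmx _]mxpoly_vecK -/(var_F y) Fy0 vec_mxpoly0.
by rewrite -[X in row_mx 0 (row_mx 0 X)]rVpolyK -/(var_h y) g0 linear0 !row_mx0.
Qed.

End Problem.

(** * Second-order sufficiency *)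

Section CriticalPoint.
Context (R : realType) (n d m k : nat).
Implicit Types x y v : 'rV[R]_(nvars n d m k).
Variables (S : 'I_k -> 'M[{poly R}]_n) (B : 'M[{poly R}]_n).
Hypotheses (Sd : forall i, degmx_le d (S i)) (Sfree : free_directions S).

(* The critical data of the problem depend only on [B], [S] and this point,   *)
(* the solution recentred at [B].                                             *)
Definition recentred_solution (z : 'rV[R]_(nvars n d m k)) : Prop :=
  [/\ lsubmx z = 0, \adj B = var_h z *: var_F z,
      normalized m (var_h z) = 1%:M, var_h z \is monic
    & max_common_divisor (var_h z) (\adj B)].

(** A monic gcd is unique, and F follows by cancelling h, which is non-zero. *)
Lemma recentred_solution_unique z z' :
  recentred_solution z -> recentred_solution z' -> z = z'.
Proof.
move=> [z0 Bz _ zm zmax] [z'0 Bz' _ z'm z'max].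
have hE : var_h z = var_h z'.
  exact: max_common_divisor_monic_unique zmax z'max.
have FE : var_F z = var_F z'.
  apply/matrixP => i j; apply: (mulfI (monic_neq0 zm)).
  have /matrixP/(_ i j) : var_h z *: var_F z = var_h z *: var_F z'.
    by rewrite -Bz hE.
  by rewrite mxE [RHS]mxE.
rewrite -[z]hsubmxK -[z']hsubmxK z0 z'0; congr row_mx.
rewrite -[LHS]hsubmxK -[RHS]hsubmxK; congr row_mx.
  by apply: (can_inj (@mxpoly_vecK R n (cof_size n d m))).
by apply: (can_inj (@rVpolyK R m.+1)).
Qed.

Variable z : 'rV[R]_(nvars n d m k).
Hypothesis zsol : recentred_solution z.

Let J := 'J (constraints B 0 S) z.
Let D := direction_mx d m S.
Let H j := hess (fun x => constraints B 0 S x 0 j) z.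

(** The block matrix formed by [J] and [D] has trivial left kernel, hence a right inverse [Z]. On
    the kernel of [J] only the lower block of [Z] acts. *)
Lemma jacobian_kernel_factor :
  exists W, forall y : 'rV_(nvars n d m k), y *m J = 0 -> y = y *m D *m W.
Proof.
have : row_free (row_mx J D).
  apply: inj_row_free => y; rewrite mul_mx_row -[RHS]row_mx0.
  move=> /eq_row_mx[yJ /(direction_mx_eq0 Sd Sfree) y0].
  by case: zsol => z0 Bz hz _ zmax; apply: constraints_kernel_eq0 yJ y0.
move=> /row_freeP[Z JDZ]; exists (dsubmx Z) => y yJ.
rewrite -[LHS]mulmx1 -JDZ mulmxA mul_mx_row yJ -{1}[Z]vsubmxK.
by rewrite mul_row_col mul0mx add0r.
Qed.

Section Translation.
Variables (A E : 'M[{poly R}]_n) (x : 'rV[R]_(nvars n d m k)).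
Hypotheses (AB : A + pert E S x = B) (xz : x - row_mx (lsubmx x) 0 = z).

Lemma constraints_recentre :
  @constraints R n d m k A E S =
  fun x' => constraints B 0 S (x' - row_mx (lsubmx x) 0).
Proof. by apply/funext => x'; rewrite (constraints_translate _ _ _ x) AB. Qed.

Lemma derive_recentre v (j : 'I_(nconstr n d)) :
  'D_v (fun x' => constraints A E S x' 0 j) =
  fun x' => 'D_v (fun x => constraints B 0 S x 0 j) (x' - row_mx (lsubmx x) 0).
Proof.
rewrite constraints_recentre.
exact: (derive_translate (fun x => constraints B 0 S x 0 j)).
Qed.

Lemma jacobian_recentre : 'J (constraints A E S) x = J.
Proof.
apply/matrixP => i j.
have PA := @polyfun_constraints R n d m k A E S.
have PB := @polyfun_constraints R n d m k B 0 S.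
apply: etrans (jacobianE _ i j PA) (etrans _ (esym (jacobianE _ i j PB))).
by have /(congr1 (@^~ x)) := derive_recentre (delta_mx 0 i) j; rewrite xz.
Qed.

Lemma derive2_recentre y (j : 'I_(nconstr n d)) :
  'D_y ('D_y (fun x' => constraints A E S x' 0 j)) x = (y *m H j *m y^T) 0 0.
Proof.
have PB := @polyfun_constraints R n d m k B 0 S.
apply: etrans (congr1 (fun f => 'D_y f x) (derive_recentre y j)) _.
apply: etrans _ (esym (hessE _ _ (PB j))).
have /(congr1 (@^~ x)) := derive_translate
  ('D_y (fun x => constraints B 0 S x 0 j)) y (row_mx (lsubmx x) 0).
by rewrite xz.
Qed.

(** Multipliers solve a linear system whose right-hand side is linear in the perturbation; a
    pseudo-inverse gives one solution of controlled norm, to which [lam] is compared. *)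
Lemma min_norm_multipliers_le lam : degmx_le d E ->
  min_norm_multipliers A E S x lam ->
  norm2 lam <= normF (pert E S x) * norm1_mx (- 2 *: (D^T *m pinvmx J^T)).
Proof.
move=> Ed [[gx glam] lam_min].
(* With [J] transparent, [rewrite] unfolds the constraints of [A] and of [B]   *)
(* to compare them.                                                           *)
have JE := jacobian_recentre; clearbody J.
have gradL mu : grad (fun x => lagrangian A E S x mu) x =
    2 *: (pert_vec E S x *m D^T) + mu *m J^T.
  by rewrite grad_lagrangian // grad_objective // JE.
rewrite (normF_pert Ed Sd).
apply: le_trans (norm2_mul_le _ _); apply: lam_min; split; last first.
  by rewrite grad_lagrangian_multiplier -(grad_lagrangian_multiplier _ _ _ lam).
apply: etrans (gradL _) _; move: gx; rewrite gradL => gx.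
(* The given [lam] shows that the system is consistent, which is what makes [pinvmx] produce a
   solution. *)
have rowJ : (pert_vec E S x *m D^T <= J^T)%MS.
  apply/submxP; exists (- 2^-1 *: lam); rewrite -scalemxAl.
  have -> : lam *m J^T = - (2 *: (pert_vec E S x *m D^T)).
    by apply/eqP; rewrite -addr_eq0 addrC gx.
  by rewrite scalerN scaleNr opprK scalerA mulVf ?scale1r ?pnatr_eq0.
rewrite -scalemxAr -scalemxAl mulmxA mulmxKpV //.
by rewrite scaleNr subrr.
Qed.

End Translation.

Lemma second_order_sufficient_near : exists2 eps : R, 0 < eps &
  forall (A E : 'M[{poly R}]_n) x (lam : 'rV[R]_(nconstr n d)),
    degmx_le d E -> A + pert E S x = B -> x - row_mx (lsubmx x) 0 = z ->
    min_norm_multipliers A E S x lam -> normF (pert E S x) < eps ->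
    second_order_sufficient A E S x lam.
Proof.
have [W WP] := jacobian_kernel_factor.
pose C1 := norm1_mx (- 2 *: (D^T *m pinvmx J^T)).
pose C2 := \sum_j norm1_mx (W *m H j *m W^T).
have C1_0 : 0 <= C1 by exact: norm1_mx_ge0.
have C2_0 : 0 <= C2 by apply: sumr_ge0 => j _; exact: norm1_mx_ge0.
have C0 : 0 < 1 + C1 * C2 by rewrite ltr_pwDl // mulr_ge0.
(* Below this threshold, [norm2 lam * C2] is at most C1 C2 / (1 + C1 C2), hence less than 1; the
   summand 1 also covers C1 C2 = 0. *)
exists (1 + C1 * C2)^-1; first by rewrite invr_gt0.
move=> A E x lam Ed AB xz lam_min small y y0.
rewrite (jacobian_recentre AB xz) => yJ.
have lam_le : norm2 lam * C2 < 1.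
  apply: (@le_lt_trans _ _ ((1 + C1 * C2)^-1 * (C1 * C2))).
    rewrite mulrA ler_wpM2r //.
    apply: le_trans (min_norm_multipliers_le AB xz Ed lam_min) _.
    by rewrite ler_wpM2r // ltW.
  by rewrite ltr_pdivrMl // mulr1 ltrDr.
rewrite hessE; last exact: polyfun_lagrangian.
rewrite derive2_lagrangian // -/D.
set u := y *m D.
have yu : y = u *m W by exact: WP.
have u0 : 0 < norm2 u ^+ 2.
  rewrite exprn_gt0 // lt_neqAle norm2_ge0 andbT eq_sym norm2_eq0.
  by apply: contraNneq y0 => u0; rewrite yu u0 mul0mx.
have sum_le : `|\sum_j lam 0 j *
    'D_y ('D_y (fun x => constraints A E S x 0 j)) x| <=
    norm2 u ^+ 2 * (norm2 lam * C2).
  rewrite mulrCA !mulr_sumr; apply: le_trans (ler_norm_sum _ _ _) _.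
  apply: ler_sum => j _; rewrite normrM ler_pM ?ler_norm2_coord //.
  rewrite (derive2_recentre AB xz) yu trmx_mul !mulmxA.
  by rewrite -(mulmxA u) -(mulmxA u) quadratic_form_le.
move: sum_le; rewrite ler_norml => /andP[sum_ge _].
(* The constraints cost less than one of the two copies of |u|^2 supplied by the objective. *)
have : norm2 u ^+ 2 * (norm2 lam * C2) < norm2 u ^+ 2 by rewrite gtr_pMr.
lra.
Qed.

End CriticalPoint.

(* "Sufficiently small": the threshold eps depends on n, d, m, the directions
   S of the structure and the perturbed matrix B = A + DeltaA*, but neither on
   A nor on DeltaA*.  (A threshold allowed to depend on A would be vacuous as
   soon as the minimum is non-zero.) *)
Theorem theorem4p4 (R : realType) (n d m k : nat)
  (n_ge1 : (0 < n)%N) (m_ge1 : (0 < m)%N)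
  (S : 'I_k -> 'M[{poly R}]_n)
  (S_deg : forall i, degmx_le d (S i))
  (S_free : free_directions S)
  (B : 'M[{poly R}]_n) :
  exists2 eps : R, 0 < eps &
    forall (A S0 : 'M[{poly R}]_n)
           (x : 'rV[R]_(nvars n d m k)) (lam : 'rV[R]_(nconstr n d)),
      degmx_le d A -> degmx_le d S0 ->
      A + pert S0 S x = B ->
      minimal_solution A S0 S x ->
      \det (A + pert S0 S x) != 0 ->
      min_norm_multipliers A S0 S x lam ->
      var_h x \is monic ->
      max_common_divisor (var_h x) (\adj (A + pert S0 S x)) ->
      normF (pert S0 S x) < eps ->
      second_order_sufficient A S0 S x lam.
Proof.
have recentre A S0 (x : 'rV[R]_(nvars n d m k)) :
    A + pert S0 S x = B -> minimal_solution A S0 S x ->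
    var_h x \is monic -> max_common_divisor (var_h x) (\adj B) ->
    recentred_solution B (x - row_mx (lsubmx x) 0).
  move=> AB [[adjE norm1] _] hmonic hmax.
  have rE : rsubmx (x - row_mx (lsubmx x) 0) = rsubmx x.
    by rewrite linearB /= row_mxKr subr0.
  split; rewrite /var_h /var_F ?rE //; last by rewrite -AB.
  by rewrite linearB /= row_mxKl subrr.
(* The threshold must be chosen before [x] is known, hence the case split on whether [B] admits a
   recentred solution at all; by uniqueness, any one serves for every [x]. *)
have [[z zsol]|nosol] :=
  pselect (exists z : 'rV[R]_(nvars n d m k), recentred_solution B z).
  have [eps eps0 epsP] := second_order_sufficient_near S_deg S_free zsol.
  exists eps => // A S0 x lam _ S0_deg AB xmin _ lam_min hmonic hmax small.
  rewrite AB in hmax; apply: epsP => //.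
  exact: recentred_solution_unique (recentre _ _ _ AB xmin hmonic hmax) zsol.
(* Without a recentred solution the hypotheses on [x] are contradictory, so any positive threshold
   will do. *)
exists 1 => // A S0 x lam _ _ AB xmin _ _ hmonic hmax _.
rewrite AB in hmax; case: nosol; exists (x - row_mx (lsubmx x) 0).
exact: recentre AB xmin hmonic hmax.
Qed.
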